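(* Let $A$ be a closed symmetric operator in a complex Hilbert space $H$ (its domain need not be dense) which is invertible (injective), and suppose that $A$ has finite defect numbers, i.e. $\dim\mathcal{N}_z(A)<\infty$ for $z\in\mathbb{C}_+$ and for $z\in\mathbb{C}_-$. Then there exist a Hilbert space $\widetilde H\supseteq H$ (containing $H$ as a closed subspace) and an invertible (injective) self-adjoint operator $\widetilde A$ in $\widetilde H$ with $\widetilde A\supseteq A$.
   Context: For $z\in\mathbb{C}\setminus\mathbb{R}$, $\mathcal{N}_z(A)=H\ominus (A-zE_H)D(A)$ is the defect subspace; its dimension is constant on each of the half-planes $\mathbb{C}_+$ and $\mathbb{C}_-$ (these are the defect numbers). *)

(* Defs.v *)
(* scalars are the complex numbers R[i] over an abstract
   real field R : realType (mathcomp-analysis), built with mathcomp-real-closed. *)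
From HB Require Import structures.
From mathcomp Require Import all_boot all_order all_algebra.
From mathcomp Require Import reals.
From mathcomp Require Import complex.
Set Implicit Arguments. Unset Strict Implicit. Unset Printing Implicit Defensive.
Import Order.TTheory GRing.Theory Num.Theory.
Local Open Scope ring_scope.

Section Hilbert.
Variable R : realType.
Local Notation C := (R[i]).
Variable H : lmodType C.
Variable ip : H -> H -> C.   (* inner product, linear in the 1st argument *)

(* the norm induced by ip *)
Definition hnorm (x : H) : R := Num.sqrt (complex.Re (ip x x)).

(* elementary (epsilon-N) norm convergence of sequences in H *)
Definition hconv (u : nat -> H) (x : H) : Prop :=
  forall e : R, 0 < e -> exists N : nat, forall n, (N <= n)%N -> hnorm (u n - x) < e.

Definition hcauchy (u : nat -> H) : Prop :=
  forall e : R, 0 < e -> exists N : nat,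
    forall m n, (N <= m)%N -> (N <= n)%N -> hnorm (u m - u n) < e.

(* (H, ip) is a complex Hilbert space *)
Definition is_hilbert : Prop :=
  [/\ (forall (a : C) (x y z : H), ip (a *: x + y) z = a * ip x z + ip y z),
      (forall x y : H, ip y x = (ip x y)^*),
      (forall x : H, 0 <= ip x x),
      (forall x : H, ip x x = 0 -> x = 0) &
      (forall u : nat -> H, hcauchy u -> exists x, hconv u x)].

(* A (not necessarily densely defined) linear operator: domain D, action A
   (the values of A outside D are irrelevant). *)
Definition is_operator (D : H -> Prop) (A : H -> H) : Prop :=
  [/\ D 0,
      (forall (a : C) x y, D x -> D y -> D (a *: x + y)) &
      (forall (a : C) x y, D x -> D y -> A (a *: x + y) = a *: A x + A y)].

(* closed: the graph is closed *)
Definition is_closed_op (D : H -> Prop) (A : H -> H) : Prop :=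
  forall (u : nat -> H) x y, (forall n, D (u n)) -> hconv u x ->
    hconv (fun n => A (u n)) y -> D x /\ A x = y.

Definition is_symmetric (D : H -> Prop) (A : H -> H) : Prop :=
  forall x y, D x -> D y -> ip (A x) y = ip x (A y).

Definition is_dense (D : H -> Prop) : Prop :=
  forall (y : H) (e : R), 0 < e -> exists x, D x /\ hnorm (y - x) < e.

(* self-adjoint: densely defined and A = A^* *)
Definition is_selfadjoint (D : H -> Prop) (A : H -> H) : Prop :=
  [/\ is_dense D, is_symmetric D A &
      (forall y z : H, (forall x, D x -> ip (A x) y = ip x z) -> D y /\ A y = z)].

(* invertible = injective on its domain *)
Definition is_injective_op (D : H -> Prop) (A : H -> H) : Prop :=
  forall x y, D x -> D y -> A x = A y -> x = y.

(* defect subspace N_z(A) = H (-) (A - z)D(A) *)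
Definition defect_space (D : H -> Prop) (A : H -> H) (z : C) : H -> Prop :=
  fun y => forall x, D x -> ip (A x - z *: x) y = 0.

(* a subset of H is contained in a finite-dimensional subspace, i.e.
   (for a subspace) it has finite dimension *)
Definition finite_dim (S : H -> Prop) : Prop :=
  exists (n : nat) (v : 'I_n -> H), forall y, S y ->
    exists c : 'I_n -> C, y = \sum_(i < n) c i *: v i.

End Hilbert.

(* Main.v *)
(* A self-adjoint operator is injective iff -1 is not an eigenvalue of its Cayley
   transform, and every unitary operator without eigenvalue 1 is such a transform.
   The Cayley transform V of A is an isometry between closed subspaces of H
   without eigenvalues 1 and -1. On H x H, the partial isometry V + V^-1 extends
   to a unitary operator by exchanging the two defect spaces, and one of the two
   exchanges may be multiplied by any phase t of modulus 1. If U_s w = l w and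
   U_t w' = l w' with s <> t and l = 1 or -1, then comparing the inner products
   of w, w' and of their images shows that the components of w and w' in the
   second defect space are orthogonal; they are nonzero if w and w' are. Since
   this defect space has finite dimension, only finitely many phases produce the
   eigenvalue 1 or -1, and the inverse Cayley transform of U_t for any other
   phase is the required extension. *)
Require Import Defs.
From HB Require Import structures.
From mathcomp Require Import all_boot all_order all_algebra.
From mathcomp Require Import reals boolp classical_sets.
From mathcomp Require Import complex ring lra.
Import Order.TTheory GRing.Theory Num.Theory.
Local Open Scope ring_scope.

(** * Inner product, its real part, and norm convergence *)

Lemma conjcE (R : realType) (x : R[i]) : x^* = conjc x.
Proof. by []. Qed.

Lemma Re_conj (R : realType) (x : R[i]) : complex.Re x^* = complex.Re x.
Proof. by rewrite conjcE; case: x. Qed.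

Section InnerProduct.
Context {R : realType} {H : lmodType R[i]} {ip : H -> H -> R[i]}.
Hypothesis hilb : is_hilbert ip.

Lemma ipDl x y z : ip (x + y) z = ip x z + ip y z.
Proof. by case: hilb => lin *; rewrite -[x]scale1r lin mul1r scale1r. Qed.

Lemma ip0l z : ip 0 z = 0.
Proof. by apply: (addrI (ip 0 z)); rewrite -ipDl !addr0. Qed.

Lemma ipZl a x z : ip (a *: x) z = a * ip x z.
Proof. by case: hilb => lin *; rewrite -[a *: x]addr0 lin ip0l addr0. Qed.

Lemma ipC x y : ip y x = (ip x y)^*.
Proof. by case: hilb. Qed.

Lemma ipNl x z : ip (- x) z = - ip x z.
Proof. by rewrite -scaleN1r ipZl mulN1r. Qed.

Lemma ipBl x y z : ip (x - y) z = ip x z - ip y z.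
Proof. by rewrite ipDl ipNl. Qed.

Lemma ipDr x y z : ip z (x + y) = ip z x + ip z y.
Proof. by rewrite ipC ipDl rmorphD /= -!ipC. Qed.

Lemma ip0r z : ip z 0 = 0.
Proof. by rewrite ipC ip0l rmorph0. Qed.

Lemma ipZr a x z : ip z (a *: x) = a^* * ip z x.
Proof. by rewrite ipC ipZl rmorphM /= -!ipC. Qed.

Lemma ipNr x z : ip z (- x) = - ip z x.
Proof. by rewrite ipC ipNl rmorphN /= -!ipC. Qed.

Lemma ipBr x y z : ip z (x - y) = ip z x - ip z y.
Proof. by rewrite ipDr ipNr. Qed.

Lemma ip_eq0 x : ip x x = 0 -> x = 0.
Proof. by case: hilb => _ _ _ + _; apply. Qed.

Lemma ip_suml n (f : 'I_n -> H) z :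
  ip (\sum_(k < n) f k) z = \sum_(k < n) ip (f k) z.
Proof. exact: (big_morph _ (fun x y => ipDl x y z) (ip0l z)). Qed.

(** Squared norms become elements of the ordered field [R], so that estimates avoid square roots and
    are within reach of [lra]. *)
Definition rip x y : R := complex.Re (ip x y).

Lemma ripDl x y z : rip (x + y) z = rip x z + rip y z.
Proof. by rewrite /rip ipDl; case: (ip x z) (ip y z) => a b []. Qed.

Lemma ripC x y : rip y x = rip x y.
Proof. by rewrite /rip ipC Re_conj. Qed.

Lemma ripDr x y z : rip z (x + y) = rip z x + rip z y.
Proof. by rewrite ripC ripDl -!(ripC z). Qed.

Lemma ripNl x z : rip (- x) z = - rip x z.
Proof. by rewrite /rip ipNl; case: (ip x z). Qed.

Lemma ripNr x z : rip z (- x) = - rip z x.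
Proof. by rewrite ripC ripNl -!(ripC z). Qed.

Lemma ripZl (t : R) x z : rip (t%:C%C *: x) z = t * rip x z.
Proof. by rewrite /rip ipZl; case: (ip x z) => a b /=; ring. Qed.

Lemma ripZr (t : R) x z : rip z (t%:C%C *: x) = t * rip z x.
Proof. by rewrite ripC ripZl -!(ripC z). Qed.

Definition ripE := (ripDl, ripDr, ripNl, ripNr, ripZl, ripZr).

Lemma ipxx_rip x : ip x x = (rip x x)%:C%C.
Proof.
case: hilb => _ _ /(_ x) + _ _; rewrite /rip lecE.
by case: (ip x x) => a b /= /andP[/eqP -> _].
Qed.

Lemma rip_ge0 x : 0 <= rip x x.
Proof. by case: hilb => _ _ /(_ x) + _ _; rewrite /rip lecE => /andP[]. Qed.

Lemma rip_eq0 x : rip x x = 0 -> x = 0.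
Proof. by move=> x0; apply: ip_eq0; rewrite ipxx_rip x0. Qed.

Lemma rip_add_le x y : rip (x + y) (x + y) <= 2 * rip x x + 2 * rip y y.
Proof. by have := rip_ge0 (x - y); rewrite !ripE (ripC x y); lra. Qed.

Lemma hnorm_lt x (e : R) : 0 < e -> (hnorm ip x < e) = (rip x x < e ^+ 2).
Proof.
move=> e0; rewrite /hnorm -(@ltr_pXn2r _ 2)// ?nnegrE ?sqrtr_ge0 ?(ltW e0)//.
by rewrite sqr_sqrtr // rip_ge0.
Qed.

Lemma hnorm_lt_sqrt x (e : R) :
  0 < e -> (hnorm ip x < Num.sqrt e) = (rip x x < e).
Proof. by move=> e0; rewrite hnorm_lt ?sqrtr_gt0// sqr_sqrtr// ltW. Qed.

Lemma hconv_rip u x : hconv ip u x <->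
  forall e : R, 0 < e -> exists N : nat,
    forall n, (N <= n)%N -> rip (u n - x) (u n - x) < e.
Proof.
split=> ux e e0.
  have [|N Nx] := ux (Num.sqrt e); first by rewrite sqrtr_gt0.
  by exists N => n /Nx; rewrite hnorm_lt_sqrt.
have [|N Nx] := ux (e ^+ 2); first by rewrite exprn_gt0.
by exists N => n /Nx; rewrite hnorm_lt.
Qed.

Lemma hcauchy_rip u : hcauchy ip u <->
  forall e : R, 0 < e -> exists N : nat, forall m n, (N <= m)%N -> (N <= n)%N ->
    rip (u m - u n) (u m - u n) < e.
Proof.
split=> ux e e0.
  have [|N Nx] := ux (Num.sqrt e); first by rewrite sqrtr_gt0.
  by exists N => m n Nm Nn; have := Nx m n Nm Nn; rewrite hnorm_lt_sqrt.
have [|N Nx] := ux (e ^+ 2); first by rewrite exprn_gt0.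
by exists N => m n Nm Nn; have := Nx m n Nm Nn; rewrite hnorm_lt.
Qed.

Lemma hcauchy_hconv u : hcauchy ip u -> exists x, hconv ip u x.
Proof. by case: hilb => _ _ _ _; apply. Qed.

Lemma hconv_hcauchy u x : hconv ip u x -> hcauchy ip u.
Proof.
move=> /hconv_rip ux; apply/hcauchy_rip => e e0.
have [|N Nx] := ux (e / 4); first by lra.
exists N => m n Nm Nn; have -> : u m - u n = (u m - x) + (x - u n).
  by rewrite addrA subrK.
apply: le_lt_trans (rip_add_le _ _) _.
rewrite -(opprB (u n) x) ripNl ripNr opprK.
have := Nx m Nm; have := Nx n Nn; lra.
Qed.

Lemma hconv_comb (a b : R[i]) {u v x y} : hconv ip u x -> hconv ip v y ->
  hconv ip (fun n => a *: u n + b *: v n) (a *: x + b *: y).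
Proof.
have scale c z : rip (c *: z) (c *: z) = complex.Re (c * c^*) * rip z z.
  rewrite /rip ipZl ipZr ipxx_rip mulrA.
  by rewrite conjcE; case: c => p q /=; ring.
have scale_ge0 (c : R[i]) : 0 <= complex.Re (c * c^*).
  by rewrite conjcE; case: c => p q /=;
    rewrite mulrN opprK -!expr2 addr_ge0 ?sqr_ge0.
move=> /hconv_rip ux /hconv_rip vy; apply/hconv_rip => e e0.
set ca := complex.Re (a * a^*); set cb := complex.Re (b * b^*).
(* The [+ 1] keeps the divisor positive for a zero scalar; the factor 4 leaves each term of
   [rip_add_le] less than half of [e]. *)
have ca0 : 0 < 4 * (ca + 1) by have := scale_ge0 a; rewrite -/ca; lra.
have cb0 : 0 < 4 * (cb + 1) by have := scale_ge0 b; rewrite -/cb; lra.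
have [N1 N1x] := ux _ (divr_gt0 e0 ca0).
have [N2 N2x] := vy _ (divr_gt0 e0 cb0).
exists (maxn N1 N2) => n; rewrite geq_max => /andP[/N1x lt1 /N2x lt2].
have -> : a *: u n + b *: v n - (a *: x + b *: y) =
    a *: (u n - x) + b *: (v n - y).
  by rewrite !scalerBr opprD addrACA.
apply: le_lt_trans (rip_add_le _ _) _; rewrite !scale -/ca -/cb.
move: lt1 lt2; rewrite !ltr_pdivlMr //.
have := rip_ge0 (u n - x); have := rip_ge0 (v n - y); lra.
Qed.

(* The bound is the discriminant of the nonnegative quadratic
   [rip (w - t s) (w - t s) - d] in [t]; for [d = 0] it is Cauchy-Schwarz. *)
Lemma rip_discriminant (d : R) w s :
  (forall t : R, d <= rip (w - t%:C%C *: s) (w - t%:C%C *: s)) ->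
  rip w s ^+ 2 <= (rip w w - d) * rip s s.
Proof.
move=> dle; have [s0|s0] := eqVneq (rip s s) 0.
  rewrite (rip_eq0 _ s0) /rip ip0r ip0l /= expr2 !mulr0; exact: lexx.
have sgt0 : 0 < rip s s by rewrite lt_neqAle eq_sym s0 rip_ge0.
have := dle (rip w s / rip s s); rewrite !ripE (ripC w s).
set a := rip w s; set b := rip s s; move=> le.
rewrite -subr_ge0 -(pmulr_lge0 _ sgt0) -/b.
have := ler_wpM2r (ltW sgt0) le.
rewrite -/b; set X := (X in d * b <= X).
have -> : X = rip w w * b - a ^+ 2.
  by rewrite /X; field; exact: s0.
by move=> ?; rewrite pmulr_lge0 //; lra.
Qed.

Lemma rip_CauchySchwarz w s : rip w s ^+ 2 <= rip w w * rip s s.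
Proof.
by have := rip_discriminant 0 w s (fun _ => rip_ge0 _); rewrite subr0.
Qed.

(** * Orthogonal projection onto the closure of a subspace *)

Lemma invS_lt (e : R) : 0 < e ->
  exists N : nat, forall n, (N <= n)%N -> n.+1%:R^-1 < e.
Proof.
move=> /ltr_add_invr[N]; rewrite add0r => Ne; exists N => n Nn.
by apply: le_lt_trans Ne; rewrite lef_pV2 ?posrE ?ltr0Sn // ler_nat ltnS.
Qed.

(** A minimizing sequence for the distance from [h] to [S] is Cauchy, and its limit is the
    projection. As [S] need not be closed, the foot [x] comes with a sequence of [S] converging to
    it. *)
Lemma projection (S : H -> Prop) h :
  S 0 -> (forall a x y, S x -> S y -> S (a *: x + y)) ->
  exists u x, [/\ (forall n, S (u n)), hconv ip u x &
    forall s, S s -> ip (h - x) s = 0].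
Proof.
move=> S0 SD; 
pose E : set R := fun r => exists2 s, S s & r = rip (h - s) (h - s).
pose d := inf E.
have Einf : has_inf E.
  split; first by exists (rip (h - 0) (h - 0)); exists 0.
  by exists 0 => _ [s _ ->]; apply: rip_ge0.
have d_le s : S s -> d <= rip (h - s) (h - s).
  by move=> Ss; apply: (ge_inf Einf.2); exists s.
have /choice[u uP] : forall n : nat, exists s, S s /\
    rip (h - s) (h - s) < d + n.+1%:R^-1.
  move=> n; have [|_ [s Ss ->] lt] := @inf_adherent _ _ n.+1%:R^-1 _ Einf.
    by rewrite invr_gt0 ltr0Sn.
  by exists s.
have uS n : S (u n) by case: (uP n).
have ulim n : rip (h - u n) (h - u n) < d + n.+1%:R^-1 by case: (uP n).
have [|x ux] := hcauchy_hconv u.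
  apply/hcauchy_rip => e e0; have [|N Nlt] := invS_lt (e / 4); first by lra.
  (* The midpoint of [u m] and [u n] lies in [S], so by the parallelogram law the squared distance
     of [u m] and [u n] is below twice the sum of the two excesses over [d]. *)
  exists N => m n Nm Nn; pose half : R := 2^-1.
  have := d_le (half%:C%C *: u m + (half%:C%C *: u n + 0)).
  move=> /(_ (SD _ _ _ (uS m) (SD _ _ _ (uS n) S0))).
  move: (ulim m) (ulim n) (Nlt m Nm) (Nlt n Nn); rewrite addr0 !ripE /half.
  rewrite (ripC (u m) (u n)) (ripC h (u m)) (ripC h (u n)).
  move: (m.+1%:R^-1 : R) (n.+1%:R^-1 : R) => ? ?; lra.
exists u, x; split => //.
have rip0 s : S s -> rip (h - x) s = 0.
  move=> Ss; apply/eqP; rewrite -sqrf_eq0; apply: contraT => q0.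
  have {}q0 : 0 < rip (h - x) s ^+ 2 by rewrite lt_neqAle eq_sym q0 sqr_ge0.
  have s0 := rip_ge0 s.
  (* Split [h - x] at [u n]. With this bound, [rip_discriminant] and Cauchy-Schwarz make the squares
     of both parts of [rip (h - x) s] smaller than a quarter of its square, which is absurd. *)
  have e0 : 0 < rip (h - x) s ^+ 2 / (4 * (rip s s + 1)).
    by apply: divr_gt0 => //; lra.
  have [N1 N1lt] := invS_lt _ e0; have [N2 N2lt] := (hconv_rip u x).1 ux _ e0.
  pose n := maxn N1 N2; move: (N1lt n (leq_maxl _ _)) (N2lt n (leq_maxr _ _)).
  rewrite !ltr_pdivlMr; try lra.
  have := rip_CauchySchwarz (u n - x) s.
  have /rip_discriminant : forall t : R,
      d <= rip (h - u n - t%:C%C *: s) (h - u n - t%:C%C *: s).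
    move=> t; have -> : h - u n - t%:C%C *: s = h - (t%:C%C *: s + u n).
      by rewrite opprD addrA addrAC.
    by apply: d_le; apply: SD.
  have -> : h - x = (h - u n) + (u n - x) by rewrite addrA subrK.
  rewrite (ripDl (h - u n)); set a := rip (h - u n) s; set b := rip (u n - x) s.
  have : 0 <= (a - b) ^+ 2 by rewrite sqr_ge0.
  have := ulim n; set f := rip (h - u n) _; set g := rip (u n - x) (u n - x).
  have : 0 <= g by apply: rip_ge0.
  set c := n.+1%:R^-1; have c0 : 0 < c by rewrite invr_gt0 ltr0Sn.
  move=> g0 fd ab as_ bs_ cq gq.
  have : (f - d) * rip s s <= c * rip s s by apply: ler_wpM2r => //; lra.
  lra.
(* The real part for ['i *: s] is, up to sign, the imaginary part for [s]. *)
move=> s Ss; have := rip0 _ (SD 'i _ _ Ss S0); have := rip0 _ Ss.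
rewrite addr0 /rip ipZr conjCi -complexiE.
by case: (ip _ _) => p q /= -> qE; congr (Complex _ _); lra.
Qed.

End InnerProduct.

(** * The Hilbert space H x H *)

Definition prod_ip {R : realType} {H : lmodType R[i]} (ip : H -> H -> R[i])
  (v w : H * H) : R[i] := ip v.1 w.1 + ip v.2 w.2.

Lemma prod_hilbert {R : realType} {H : lmodType R[i]} (ip : H -> H -> R[i]) :
  is_hilbert ip -> is_hilbert (prod_ip ip).
Proof.
move=> hilb; have ge0 := rip_ge0 hilb.
have ripE (w : H * H) : complex.Re (prod_ip ip w w) =
    @rip _ _ ip w.1 w.1 + @rip _ _ ip w.2 w.2.
  by rewrite /rip /prod_ip; case: (ip w.1 w.1) (ip w.2 w.2) => a b [].
have ip_ge0 x : 0 <= ip x x by case: hilb.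
split.
- move=> a x y z; rewrite /prod_ip /= !(ipDl hilb) !(ipZl hilb); ring.
- by move=> x y; rewrite /prod_ip rmorphD /= -!(ipC hilb).
- by move=> x; rewrite addr_ge0.
- case=> x y /eqP; rewrite paddr_eq0 // => /andP[/eqP/(ip_eq0 hilb)/= -> /eqP].
  by move/(ip_eq0 hilb) => /= ->.
- move=> u uC.
  have [|x ux] := hcauchy_hconv hilb (fun n => (u n).1).
    move=> e e0; have [N Nu] := uC e e0; exists N => m n Nm Nn.
    apply: le_lt_trans (Nu m n Nm Nn); apply: ler_wsqrtr.
    by rewrite ripE /= lerDl.
  have [|y uy] := hcauchy_hconv hilb (fun n => (u n).2).
    move=> e e0; have [N Nu] := uC e e0; exists N => m n Nm Nn.
    apply: le_lt_trans (Nu m n Nm Nn); apply: ler_wsqrtr.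
    by rewrite ripE /= lerDr.
  exists (x, y) => e e0; have e2 : 0 < e / 2 by lra.
  have [N1 N1u] := ux _ e2; have [N2 N2u] := uy _ e2.
  exists (maxn N1 N2) => n; rewrite geq_max => /andP[/N1u + /N2u].
  rewrite !(hnorm_lt hilb) // => lt1 lt2.
  rewrite /hnorm ripE /= -[ltRHS]gtr0_norm // -sqrtr_sqr.
  rewrite ltr_sqrt ?exprn_gt0 //.
  by nra.
Qed.

(** * The inverse Cayley transform of a unitary operator *)

Section CayleyTransform.
Context {R : realType} {K : lmodType R[i]} {ip : K -> K -> R[i]}.
Hypothesis hilb : is_hilbert ip.
Variable U : K -> K.
Hypothesis U_linear : forall a x y, U (a *: x + y) = a *: U x + U y.
Hypothesis U_isometry : forall x y, ip (U x) (U y) = ip x y.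
Hypothesis U_surjective : forall y, exists x, U x = y.
Hypothesis U_no_eig1 : forall x, U x = x -> x = 0.
Hypothesis U_no_eigN1 : forall x, U x = - x -> x = 0.

Let UD x y : U (x + y) = U x + U y.
Proof. by rewrite -[x]scale1r U_linear !scale1r. Qed.

Let U0 : U 0 = 0.
Proof. by apply: (addrI (U 0)); rewrite -UD !addr0. Qed.

Let UZ a x : U (a *: x) = a *: U x.
Proof. by rewrite -[a *: x]addr0 U_linear U0 !addr0. Qed.

Let UB x y : U (x - y) = U x - U y.
Proof. by rewrite UD -scaleN1r UZ scaleN1r. Qed.

Let U_sub_inj f g : U f - f = U g - g -> f = g.
Proof.
move=> eq; apply/eqP; rewrite -subr_eq0; apply/eqP/U_no_eig1.
by rewrite UB -[U f](subrK f) eq addrAC [U g - g]addrC addrK addrC.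
Qed.

(** The operator is i (U + 1) (U - 1)^-1. Without eigenvalue 1, [U - 1] is injective with dense
    range; without eigenvalue -1, [U + 1] is injective; surjectivity of [U] makes the adjoint no
    larger than the operator. *)
Lemma inverse_cayley : exists (D : K -> Prop) (A : K -> K),
  [/\ is_operator D A, is_selfadjoint ip D A, is_injective_op D A &
    forall f, D (U f - f) /\ A (U f - f) = 'i *: (U f + f)].
Proof.
pose D y := exists f, y = U f - f.
(* Injectivity of [U - 1] makes the value independent of [f]; outside [D] the value is set to 0. *)
have /choice[A AP] : forall y, exists z, forall f,
    y = U f - f -> z = 'i *: (U f + f).
  move=> y; have [[f yf]|nD] := pselect (D y); last first.
    by exists 0 => f yf; case: nD; exists f.
  by exists ('i *: (U f + f)) => g; rewrite yf => /U_sub_inj ->.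
have AE f : A (U f - f) = 'i *: (U f + f) by apply: AP.
have ii : 'i * 'i = -1 :> R[i] by rewrite -expr2 sqrCi.
exists D, A; split; last by move=> f; split; first exists f.
- have comb a f g : a *: (U f - f) + (U g - g) =
      U (a *: f + g) - (a *: f + g).
    by rewrite U_linear scalerBr opprD addrACA.
  split.
  + by exists 0; rewrite U0 subrr.
  + by move=> a _ _ [f ->] [g ->]; rewrite comb; exists (a *: f + g).
  + move=> a _ _ [f ->] [g ->]; rewrite comb !AE U_linear.
    rewrite addrACA -(scalerDr a (U f)) (scalerDr 'i (a *: _)).
    by rewrite !scalerA mulrC.
- split.
  + move=> y e e0.
    have [||u [x [uD ux xperp]]] := projection hilb D y.
    * by exists 0; rewrite U0 subrr.
    * move=> a _ _ [f ->] [g ->]; exists (a *: f + g).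
      by rewrite U_linear scalerBr opprD addrACA.
    (* If [w] is orthogonal to the range of [U - 1], then [ip (U w) w = ip w w], and expanding the
       square of [U w - w] gives 0, so [w] is fixed by [U]. *)
    have perp0 w : (forall s, D s -> ip w s = 0) -> w = 0.
      move=> perp; apply: U_no_eig1; apply/eqP; rewrite -subr_eq0; apply/eqP.
      have wUw : ip w (U w) - ip w w = 0.
        by rewrite -(ipBr hilb); apply: perp; exists w.
      have Uww : ip (U w) w = ip w w.
        by rewrite (ipC hilb) (subr0_eq wUw) -(ipC hilb).
      apply: (ip_eq0 hilb).
      by rewrite (ipBl hilb) !(ipBr hilb) U_isometry Uww wUw !subrr.
    have w0 := perp0 _ xperp.
    have [N Nx] := ux e e0; exists (u N); split => //.
    rewrite (subr0_eq w0); apply: le_lt_trans (Nx N (leqnn N)).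
    apply: ler_wsqrtr; rewrite -(opprB (u N)) (ipNl hilb) (ipNr hilb) opprK.
    exact: lexx.
  + move=> _ _ [f ->] [g ->]; rewrite !AE.
    rewrite (ipZl hilb) (ipZr hilb) conjCi.
    rewrite !(ipDl hilb, ipDr hilb, ipNl hilb, ipNr hilb).
    by rewrite !U_isometry; ring.
  (* The adjoint relation rearranges to [ip (U f) (- ('i *: y) - z) = ip f ('i *: y - z)], so the
     preimage [k] must be ['i *: y - z]. Then [U k - k] is -2i y and [U k + k] is -2z, whence the
     factor i/2 below. *)
  + move=> y z yz; have [k Uk] := U_surjective (- ('i *: y) - z).
    have kE : k = 'i *: y - z.
      suff perp0 f : ip f (k - ('i *: y - z)) = 0.
        by apply/subr0_eq/(ip_eq0 hilb)/perp0.
      have := yz (U f - f) (ex_intro _ f erefl); rewrite AE.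
      rewrite (ipZl hilb) (ipDl hilb) (ipBl hilb _ _ z) => eq.
      have := U_isometry f k.
      rewrite Uk !(ipBr hilb) (ipNr hilb) !(ipZr hilb) conjCi => <-.
      move/eqP: eq; rewrite -subr_eq0 => /eqP <-; ring.
    pose c : R[i] := 'i / 2.
    have yE : y = U (c *: k) - c *: k.
      rewrite UZ -scalerBr Uk kE opprB addrA subrK.
      rewrite -opprD -scalerDl -scaleNr scalerA.
      rewrite -[LHS]scale1r; congr (_ *: _).
      by rewrite -[LHS]opprK -ii /c; field.
    split; first by exists (c *: k).
    rewrite {1}yE AE UZ -scalerDr Uk kE addrACA addNr add0r.
    rewrite -opprD -mulr2n -scaler_nat -scaleNr !scalerA.
    rewrite -[RHS]scale1r; congr (_ *: _).
    by rewrite -[RHS]opprK -ii /c; field.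
- move=> _ _ [f ->] [g ->]; rewrite !AE => /(scalerI _) eq.
  suff -> : f = g by [].
  apply/eqP; rewrite -subr_eq0; apply/eqP/U_no_eigN1.
  rewrite UB opprB; apply/eqP; rewrite subr_eq addrAC; apply/eqP.
  by rewrite [g + _]addrC -eq ?addrK // neq0Ci.
Qed.

End CayleyTransform.

(** The n + 1 vectors satisfy a nontrivial linear relation; pairing it with a vector whose
    coefficient is nonzero leaves only the square of that vector. *)
Lemma orthogonal_family_has0 {R : realType} {H : lmodType R[i]}
    (ip : H -> H -> R[i]) n (v : 'I_n -> H) (f : 'I_n.+1 -> H) :
  is_hilbert ip ->
  (forall k, exists c : 'I_n -> R[i], f k = \sum_(i < n) c i *: v i) ->
  (forall j k, j != k -> ip (f j) (f k) = 0) ->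
  exists k, f k = 0.
Proof.
move=> hilb /choice[c fE] orth.
pose M : 'M[R[i]]_(n.+1, n) := \matrix_(k, i) c k i.
have : kermx M != 0.
  rewrite kermx_eq0 /row_free neq_ltn; apply/orP; left.
  exact: leq_ltn_trans (rank_leq_col M) _.
move=> /rowV0Pn[a /sub_kermxP aM /rV0Pn[k ak]]; exists k.
have sum0 : \sum_(j < n.+1) a 0 j *: f j = 0.
  under eq_bigr => j _ do rewrite fE scaler_sumr.
  rewrite exchange_big big1 //= => i _.
  under eq_bigr => j _ do rewrite scalerA.
  rewrite -scaler_suml; move/matrixP: aM => /(_ 0 i); rewrite !mxE.
  by under eq_bigr => j _ do rewrite mxE; move=> ->; rewrite scale0r.
apply: (ip_eq0 hilb); have := congr1 (ip^~ (f k)) sum0.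
rewrite /= (ip0l hilb) (ip_suml hilb) (bigD1 k) //= big1 ?addr0; last first.
  by move=> j jk; rewrite (ipZl hilb) orth ?mulr0.
by rewrite (ipZl hilb) => /eqP; rewrite mulf_eq0 (negPf ak) => /= /eqP.
Qed.

(** * Ranges of [A - z] for a symmetric operator and z = i or -i *)

Definition shift {R : realType} {H : lmodType R[i]} (A : H -> H) (z : R[i]) x :=
  A x - z *: x.

Section SymmetricOperator.
Context {R : realType} {H : lmodType R[i]} {ip : H -> H -> R[i]}.
Context {D : H -> Prop} {A : H -> H}.
Hypothesis hilb : is_hilbert ip.
Hypothesis opA : is_operator D A.
Hypothesis symA : is_symmetric ip D A.

Local Notation B := (shift A).

Let D0 : D 0. Proof. by case: opA. Qed.

Let D_lin a x y : D x -> D y -> D (a *: x + y).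
Proof. by case: opA => _ + _; apply. Qed.

Let A_lin a x y : D x -> D y -> A (a *: x + y) = a *: A x + A y.
Proof. by case: opA => _ _; apply. Qed.

Lemma shift_lin z a x y : D x -> D y ->
  B z (a *: x + y) = a *: B z x + B z y.
Proof.
move=> Dx Dy; rewrite /shift A_lin // scalerBr scalerDr opprD addrACA.
by rewrite !scalerA mulrC.
Qed.

Lemma shift0 z : B z 0 = 0.
Proof.
have := shift_lin z (-1) 0 0 D0 D0.
by rewrite scaler0 addr0 scaleN1r addNr.
Qed.

Lemma shiftB z x y : D x -> D y -> B z (x - y) = B z x - B z y.
Proof.
by move=> Dx Dy; rewrite addrC -scaleN1r shift_lin // scaleN1r addrC.
Qed.

Lemma domainB x y : D x -> D y -> D (x - y).
Proof. by move=> Dx Dy; rewrite addrC -scaleN1r; apply: D_lin. Qed.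

(** The cross terms cancel by symmetry. The two conditions on [z] cover i and -i at once. *)
Lemma ip_shift z x y : z^* = - z -> z * z = -1 -> D x -> D y ->
  ip (B z x) (B z y) = ip (A x) (A y) + ip x y.
Proof.
move=> zJ zz Dx Dy; rewrite /shift (ipBl hilb) !(ipBr hilb) !(ipZl hilb).
rewrite !(ipZr hilb) zJ (symA x y) //.
have -> : z * (- z * ip x y) = - (z * z) * ip x y by ring.
by rewrite zz; ring.
Qed.

Section Projection.
Context {z : R[i]}.
Hypotheses (zJ : z^* = - z) (zz : z * z = -1).

(* The graph norm of [x] is the norm of [A x - z x], so closedness of [A] makes
   the range of [A - z] closed. *)
Lemma range_projection : is_closed_op ip D A -> exists r : H -> H,
  (forall h, D (r h)) /\
  (forall h y, D y -> ip (h - B z (r h)) (B z y) = 0).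
Proof.
move=> closedA.
suff /choice[r rP] : forall h, exists x, D x /\
    forall y, D y -> ip (h - B z x) (B z y) = 0.
  by exists r; split=> h; case: (rP h).
move=> h; pose S s := exists x, D x /\ s = B z x.
have [||u [x [uS ux xperp]]] := projection hilb S h.
- by exists 0; rewrite shift0.
- move=> a _ _ [x [Dx ->]] [y [Dy ->]]; exists (a *: x + y).
  by rewrite shift_lin //; split=> //; apply: D_lin.
have [v vP] := choice uS.
have Dv n : D (v n) by case: (vP n).
have uv n : u n = B z (v n) by case: (vP n).
have [|y vy] := hcauchy_hconv hilb v.
  apply/(hcauchy_rip hilb) => e e0.
  have [N Nu] := (hcauchy_rip hilb u).1 (hconv_hcauchy hilb _ _ ux) e e0.
  exists N => m n Nm Nn; apply: le_lt_trans (Nu m n Nm Nn).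
  rewrite !uv -shiftB // /rip ip_shift //; try exact: domainB.
  have := rip_ge0 hilb (A (v m - v n)); rewrite /rip.
  by case: (ip (A _) _) (ip (v m - v n) _) => a b [c d] /=; rewrite lerDr.
(* Here [A (v n)] equals [u n + z *: v n], a combination of two convergent sequences. *)
have [Dy Ay] : D y /\ A y = x + z *: y.
  apply: (closedA v) => //; have := hconv_comb hilb 1 z ux vy.
  rewrite scale1r; congr (hconv ip _ _); apply: funext => n.
  by rewrite scale1r uv subrK.
exists y; split=> // y' Dy'; rewrite /shift Ay addrK.
by apply: xperp; exists y'.
Qed.

Section RangePreimage.
Context {r : H -> H}.
Hypothesis rD : forall h, D (r h).
Hypothesis r_perp : forall h y, D y -> ip (h - B z (r h)) (B z y) = 0.

(** The vector [B z (r h - x)] is in the range of [B z] and orthogonal to it, hence 0, and by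
    [ip_shift] its norm dominates that of [r h - x]. The algebraic rules for [r] below follow from
    this characterization. *)
Lemma preimage_unique h x : D x ->
  (forall y, D y -> ip (h - B z x) (B z y) = 0) -> r h = x.
Proof.
move=> Dx perp; apply: subr0_eq; apply: (rip_eq0 hilb).
have : ip (B z (r h - x)) (B z (r h - x)) = 0.
  have Drx := domainB _ _ (rD h) Dx; rewrite {1}shiftB //.
  have -> : B z (r h) - B z x =
      (h - B z x) - (h - B z (r h)).
    by move: (B z (r h)) (B z x) => a b;
      rewrite opprB [RHS]addrC [RHS]addrA subrK.
  by rewrite (ipBl hilb) perp // r_perp // subrr.
rewrite ip_shift //; try exact: domainB.
rewrite !(ipxx_rip hilb) => /(congr1 (@complex.Re R)) /=.
have := rip_ge0 hilb (A (r h - x)); have := rip_ge0 hilb (r h - x); lra.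
Qed.

Lemma preimage_shift x : D x -> r (B z x) = x.
Proof. by move=> Dx; apply: preimage_unique => // y Dy; rewrite subrr (ip0l hilb). Qed.

Lemma preimage_lin a g h : r (a *: g + h) = a *: r g + r h.
Proof.
apply: preimage_unique; first exact: D_lin.
move=> y Dy; rewrite shift_lin // opprD addrACA -scalerBr.
by rewrite (ipDl hilb) (ipZl hilb) !r_perp // mulr0 addr0.
Qed.

Lemma preimage_defect h : r (h - B z (r h)) = 0.
Proof. by apply: preimage_unique => // y Dy; rewrite shift0 subr0 r_perp. Qed.

Lemma preimage_perp_sym h y : D y -> ip (B z y) (h - B z (r h)) = 0.
Proof. by move=> Dy; rewrite (ipC hilb) r_perp // rmorph0. Qed.

Lemma ip_split g h : ip g h = ip (B z (r g)) (B z (r h)) +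
  ip (g - B z (r g)) (h - B z (r h)).
Proof.
have pythagoras p q p' q' : ip q p' = 0 -> ip p q' = 0 ->
    ip (q + p) (q' + p') = ip p p' + ip q q'.
  by move=> o1 o2; rewrite (ipDl hilb) !(ipDr hilb) o1 o2; ring.
by rewrite -pythagoras ?r_perp ?preimage_perp_sym // !subrK.
Qed.

End RangePreimage.
End Projection.
End SymmetricOperator.

(** * The unitary operators on H x H extending the Cayley transform *)

Section Dilation.
Context {R : realType} {H : lmodType R[i]} {ip : H -> H -> R[i]}.
Context {D : H -> Prop} {A : H -> H}.
Hypothesis hilb : is_hilbert ip.
Hypothesis opA : is_operator D A.
Hypothesis symA : is_symmetric ip D A.
Hypothesis injA : is_injective_op D A.

Local Notation Bm := (shift A 'i).
Local Notation Bp := (shift A (- 'i)).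

Context {r r' : H -> H}.
Hypothesis rD : forall h, D (r h).
Hypothesis r_perp : forall h y, D y -> ip (h - Bm (r h)) (Bm y) = 0.
Hypothesis r'D : forall h, D (r' h).
Hypothesis r'_perp : forall h y, D y -> ip (h - Bp (r' h)) (Bp y) = 0.

Let iJ : 'i^* = - 'i :> R[i]. Proof. exact: conjCi. Qed.
Let ii : 'i * 'i = -1 :> R[i]. Proof. by rewrite -expr2 sqrCi. Qed.
Let NiJ : (- 'i)^* = - (- 'i) :> R[i]. Proof. by rewrite rmorphN /= conjCi. Qed.
Let NiNi : (- 'i) * (- 'i) = -1 :> R[i]. Proof. by rewrite mulrNN. Qed.

(** This makes the Cayley transform, which sends [Bm x] to [Bp x], well defined and isometric. *)
Lemma ip_Bp_Bm x y : D x -> D y -> ip (Bp x) (Bp y) = ip (Bm x) (Bm y).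
Proof. by move=> Dx Dy; rewrite !(ip_shift hilb symA). Qed.

Let r_linear := preimage_lin hilb opA symA iJ ii rD r_perp.
Let r'_linear := preimage_lin hilb opA symA NiJ NiNi r'D r'_perp.

(* With the Cayley transform [V (Bm x) = Bp x], the orthogonal projections
   [P = Bm \o r], [P' = Bp \o r'] onto its domain and range and [T = V P], this
   is the block matrix [[T, t (1 - P')], [1 - P, T^*]]. *)
Definition dilation (t : R[i]) (w : H * H) : H * H :=
  (Bp (r w.1) + t *: (w.2 - Bp (r' w.2)), w.1 - Bm (r w.1) + Bm (r' w.2)).

Lemma dilation_linear t a v w :
  dilation t (a *: v + w) = a *: dilation t v + dilation t w.
Proof.
case: v w => [x y] [x' y']; rewrite /dilation /= r_linear r'_linear.
rewrite !(shift_lin opA) //; congr (_, _) => /=.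
  rewrite opprD addrACA -scalerBr !scalerDr !scalerA (mulrC t a).
  by rewrite [LHS]addrACA.
by rewrite opprD (addrACA (a *: x)) -scalerBr [LHS]addrACA -scalerDr.
Qed.

(** Defect components are orthogonal to the ranges they are added to, so cross terms vanish, and the
    phases enter only through the second defect component. Equal phases give isometry; distinct ones
    give the orthogonality of eigenvectors. *)
Lemma ip_dilation s t v w : prod_ip ip (dilation s v) (dilation t w) =
  prod_ip ip v w +
  (s * t^* - 1) * ip (v.2 - Bp (r' v.2)) (w.2 - Bp (r' w.2)).
Proof.
case: v w => [x y] [x' y']; rewrite /prod_ip /dilation /=.
rewrite (ip_split hilb rD r_perp x x') (ip_split hilb r'D r'_perp y y').
rewrite -(ip_Bp_Bm (r x)) // (ip_Bp_Bm (r' y)) //.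
have := r_perp x _ (r'D y'); have := preimage_perp_sym hilb r_perp x' _ (r'D y).
have := r'_perp y _ (rD x'); have := preimage_perp_sym hilb r'_perp y' _ (rD x).
move: (x - _) (x' - _) (y - _) (y' - _) => Qx Qx' Qy Qy'.
move: (Bp (r x)) (Bp (r x')) (Bm (r' y)) (Bm (r' y')).
move=> Tx Tx' Ty Ty' o1 o2 o3 o4.
rewrite !(ipDl hilb) !(ipDr hilb) !(ipZl hilb) !(ipZr hilb) o1 o2 o3 o4; ring.
Qed.

Lemma dilation_isometry t v w : t * t^* = 1 ->
  prod_ip ip (dilation t v) (dilation t w) = prod_ip ip v w.
Proof. by move=> t1; rewrite ip_dilation t1 subrr mul0r addr0. Qed.

Lemma dilation_surjective t w : t * t^* = 1 -> exists v, dilation t v = w.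
Proof.
move=> t1; case: w => a b.
(* The adjoint block matrix [[T^*, 1 - P], [t^* (1 - P'), T]] applied to (a, b). *)
exists (Bm (r' a) + (b - Bm (r b)), t^* *: (a - Bp (r' a)) + Bp (r b)).
rewrite /dilation /= -[Bm (r' a)]scale1r r_linear r'_linear !scale1r.
rewrite (preimage_shift hilb opA symA iJ ii rD r_perp) //.
rewrite (preimage_shift hilb opA symA NiJ NiNi r'D r'_perp) //.
rewrite (preimage_defect hilb opA symA iJ ii rD r_perp).
rewrite (preimage_defect hilb opA symA NiJ NiNi r'D r'_perp) scaler0 addr0 add0r.
congr (_, _); last by rewrite [Bm (r' a) + _]addrC addrK subrK.
by rewrite addrK scalerA t1 scale1r addrC subrK.
Qed.

Lemma dilation_cayley t x : D x -> dilation t (Bm x, 0) = (Bp x, 0).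
Proof.
move=> Dx; have r'0 : r' 0 = 0.
  by have := r'_linear (-1) 0 0; rewrite scaler0 addr0 scaleN1r addNr.
rewrite /dilation /= (preimage_shift hilb opA symA iJ ii rD r_perp) // r'0.
by rewrite !(shift0 opA) !subrr scaler0 !addr0.
Qed.

(** For [l = 1] the equation reduces to 2i u = 0; for [l = -1] it reduces to 2 A u = 0, where
    injectivity of [A] enters. *)
Lemma Bp_eigen_Bm l u : l = 1 \/ l = -1 -> D u -> Bp u = l *: Bm u -> u = 0.
Proof.
move=> l1 Du; have [D0 _ _] := opA.
have A0 : A 0 = 0.
  by have := shift0 opA 0; rewrite /shift scaler0 subr0.
rewrite /shift scaleNr opprK; case: l1 => ->.
  rewrite scale1r => /addrI /eqP; rewrite -subr_eq0 opprK -scalerDl scaler_eq0.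
  by rewrite -mulr2n mulrn_eq0 /= (negPf (neq0Ci _)) => /eqP.
rewrite scaleN1r opprB addrC => /addrI /eqP; rewrite -subr_eq0 opprK -mulr2n.
rewrite -scaler_nat scaler_eq0 pnatr_eq0 /= => /eqP Au.
by apply: injA => //; rewrite A0.
Qed.

(** With no second defect component, T x = l x. As T x has the norm of P x, this forces x = P x, so
    x is an eigenvector of V unless it vanishes. Then T^* y = l y with y = P' y, which is again an
    eigenvalue equation for V because l^-1 = l. *)
Lemma dilation_eigen_defect t l w : l = 1 \/ l = -1 ->
  dilation t w = l *: w -> w.2 - Bp (r' w.2) = 0 -> w = 0.
Proof.
case: w => x y l1 /= [/=]; rewrite /dilation /= => /= eq1 eq2 Q'y.
have ll : l * l^* = 1 by case: l1 => ->; rewrite ?rmorphN rmorph1 ?mulrNN mulr1.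
have ll' : l * l = 1 by case: l1 => ->; rewrite ?mulrNN mulr1.
rewrite Q'y scaler0 addr0 in eq1.
have Qx : x - Bm (r x) = 0.
  apply: (ip_eq0 hilb); have := ip_split hilb rD r_perp x x.
  rewrite -ip_Bp_Bm // eq1 (ipZl hilb) (ipZr hilb) mulrA ll mul1r.
  by rewrite -[LHS]addr0 => /addrI.
have rx : r x = 0.
  by apply: (Bp_eigen_Bm _ _ l1) => //; rewrite eq1 [in LHS](subr0_eq Qx).
have x0 : x = 0 by rewrite (subr0_eq Qx) rx (shift0 opA).
have r'y : r' y = 0.
  apply: (Bp_eigen_Bm _ _ l1) => //; rewrite Qx add0r in eq2.
  by rewrite eq2 scalerA ll' scale1r [in RHS](subr0_eq Q'y).
by rewrite x0 (subr0_eq Q'y) r'y (shift0 opA).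
Qed.

(* Eigenvectors of [dilation s] and [dilation t] for the same eigenvalue have
   orthogonal components in the defect space when [s != t]. *)
Lemma dilation_no_eigen n (v : 'I_n -> H) (t : 'I_n.+1 -> R[i]) l :
  (forall y, defect_space ip D A (- 'i) y ->
    exists c : 'I_n -> R[i], y = \sum_(i < n) c i *: v i) ->
  injective t -> (forall k, t k * (t k)^* = 1) -> l = 1 \/ l = -1 ->
  exists k, forall w, dilation (t k) w = l *: w -> w = 0.
Proof.
move=> vspan tinj t1 l1; apply: contrapT => /forallNP noK.
have /choice[w wP] : forall k, exists w, dilation (t k) w = l *: w /\ w <> 0.
  move=> k; have /existsNP[w /not_implyP[eq w0]] := noK k.
  by exists w.
pose f k := (w k).2 - Bp (r' (w k).2).
have [k|j k jk|k fk] := orthogonal_family_has0 ip n v f hilb.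
- by apply: vspan => x Dx; rewrite (preimage_perp_sym hilb r'_perp).
- have := ip_dilation (t j) (t k) (w j) (w k).
  have [-> _] := wP j; have [-> _] := wP k.
  have prodh := prod_hilbert ip hilb.
  rewrite (ipZl prodh) (ipZr prodh) mulrA.
  have -> : l * l^* = 1.
    by case: l1 => ->; rewrite ?rmorphN rmorph1 ?mulrNN mulr1.
  rewrite mul1r -[LHS]addr0 => /addrI /esym /eqP.
  rewrite mulf_eq0 => /orP[|/eqP //].
  (* If the scalar factor vanished, cancelling the conjugate of [t k] would give [t j = t k]. *)
  rewrite subr_eq0 -(t1 k) => /eqP /mulIf tjk.
  have tk0 : (t k)^* != 0.
    by apply/eqP => tk0; move/eqP: (t1 k); rewrite tk0 mulr0 eq_sym oner_eq0.
  by move/eqP: jk; case; apply: tinj; apply: tjk.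
- by case: (wP k) => eq; apply; apply: dilation_eigen_defect l1 eq fk.
Qed.

End Dilation.

(** * Infinitely many distinct numbers of modulus 1 *)

Section Phases.
Context {R : realType}.

(** The scalar Cayley map x -> (x + i) / (x - i) sends the real line injectively into the unit
    circle; here it is taken at the natural numbers. *)
Definition phase (m : nat) : R[i] := (m%:R + 'i) / (m%:R - 'i).

Lemma natr_addi_neq0 m : m%:R + 'i != 0 :> R[i] /\ m%:R - 'i != 0 :> R[i].
Proof.
apply/andP; rewrite -negb_or -mulf_eq0.
have -> : (m%:R + 'i) * (m%:R - 'i) = (m ^ 2).+1%:R :> R[i].
  by rewrite mulrC -subr_sqr sqrCi opprK -natrX natr1.
by rewrite pnatr_eq0.
Qed.

Lemma phase_unimodular m : phase m * (phase m)^* = 1.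
Proof.
have [p0 m0] := natr_addi_neq0 m.
rewrite /phase rmorphM fmorphV rmorphD rmorphB /= conjCi rmorph_nat opprK.
by field; rewrite p0 m0.
Qed.

Lemma phase_inj : injective phase.
Proof.
move=> m n; have [_ m0] := natr_addi_neq0 m; have [_ n0] := natr_addi_neq0 n.
move/eqP; rewrite /phase eqr_div // -subr_eq0.
have -> : (m%:R + 'i) * (n%:R - 'i) - (n%:R + 'i) * (m%:R - 'i) =
  'i * 2 * (n%:R - m%:R) :> R[i] by ring.
rewrite !mulf_eq0 (negPf (neq0Ci _)) pnatr_eq0 /= subr_eq0 eqr_nat.
by move/eqP.
Qed.

End Phases.

(** * Choice of the phase and the self-adjoint extension *)

Theorem theorem2 (R : realType) (H : lmodType R[i]) (ip : H -> H -> R[i])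
  (D : H -> Prop) (A : H -> H) :
  is_hilbert ip ->
  is_operator D A ->
  is_closed_op ip D A ->
  is_symmetric ip D A ->
  is_injective_op D A ->
  (forall z : R[i], complex.Im z != 0 -> finite_dim (defect_space ip D A z)) ->
  exists (Ht : lmodType R[i]) (ipt : Ht -> Ht -> R[i]) (J : H -> Ht)
         (Dt : Ht -> Prop) (At : Ht -> Ht),
    is_hilbert ipt /\
    (forall (a : R[i]) (x y : H), J (a *: x + y) = a *: J x + J y) /\
    (forall x y : H, ipt (J x) (J y) = ip x y) /\
    is_operator Dt At /\
    is_selfadjoint ipt Dt At /\
    is_injective_op Dt At /\
    (forall x, D x -> Dt (J x) /\ At (J x) = J (A x)).
Proof.
move=> hilb opA closedA symA injA fdim.
have ii : 'i * 'i = -1 :> R[i] by rewrite -expr2 sqrCi.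
have NiJ : (- 'i)^* = - (- 'i) :> R[i] by rewrite rmorphN /= conjCi.
have NiNi : (- 'i) * (- 'i) = -1 :> R[i] by rewrite mulrNN.
have [r [rD r_perp]] := range_projection hilb opA symA (conjCi _) ii closedA.
have [r' [r'D r'_perp]] := range_projection hilb opA symA NiJ NiNi closedA.
have [|n [v vspan]] := fdim (- 'i).
  by rewrite -complexiE /= oppr_eq0 oner_eq0.
pose U := @dilation R H A r r'.
have noeig (t : 'I_n.+1 -> R[i]) l := dilation_no_eigen hilb opA symA injA
  rD r_perp r'D r'_perp n v t l vspan.
(* Both eigenvalues must be avoided by one phase. Each of n + 1 disjoint blocks of n + 1 phases
   contains one without eigenvalue 1; among these n + 1 selected phases, one is also without
   eigenvalue -1. *)
have /choice[k kP] : forall j : 'I_n.+1, exists k : 'I_n.+1,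
    forall w, U (phase (j * n.+1 + k)) w = 1 *: w -> w = 0.
  move=> j; apply: (noeig (fun k : 'I_n.+1 => phase (j * n.+1 + k))).
  - by move=> k1 k2 /phase_inj /addnI /val_inj.
  - by move=> k; apply: phase_unimodular.
  - by left.
have [|||j jP] := noeig (fun j => phase (j * n.+1 + k j)) (-1).
- move=> j1 j2 /phase_inj /(congr1 (divn^~ n.+1)).
  by rewrite !divnMDl // !divn_small // !addn0 => /val_inj.
- by move=> j; apply: phase_unimodular.
- by right.
set t := phase (j * n.+1 + k j) in jP.
have t1 : t * t^* = 1 by apply: phase_unimodular.
have [Dt [At [opAt saAt injAt AtE]]] := inverse_cayley
  (prod_hilbert ip hilb) (U t)
  (dilation_linear hilb opA symA rD r_perp r'D r'_perp t)
  (fun v w => dilation_isometry hilb symA rD r_perp r'D r'_perp t v w t1)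
  (fun w => dilation_surjective hilb opA symA rD r_perp r'D r'_perp t w t1)
  (fun w Uw => kP j w (etrans Uw (esym (scale1r w))))
  (fun w Uw => jP w (etrans Uw (esym (scaleN1r w)))).
exists (H * H)%type, (prod_ip ip), (fun x => (x, 0)), Dt, At.
split; first exact: prod_hilbert.
split; first by move=> a x y; congr (_, _); rewrite /= scaler0 addr0.
split; first by move=> x y; rewrite /prod_ip /= (ip0l hilb) addr0.
split=> //; split=> //; split=> // x Dx.
have [D0 D_lin A_lin] := opA.
have A0 : A 0 = 0 by have := shift0 opA 0; rewrite /shift scaler0 subr0.
(* Since [Bp y - Bm y] is 2i y and [Bp y + Bm y] is 2 A y, the factor c = 1/(2i) turns the pair
   produced by [AtE] into x and A x. *)
pose c : R[i] := - 'i / 2; pose y := c *: x.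
have c1 : ('i + 'i) * c = 1 by rewrite -[RHS]opprK -ii /c; field.
have Dy : D y by rewrite /y -[_ *: _]addr0; apply: D_lin.
have Ay : A y = c *: A x by rewrite /y -[_ *: _]addr0 A_lin // A0 addr0.
have := AtE (shift A 'i y, 0).
rewrite /U (dilation_cayley hilb opA symA rD r_perp r'D r'_perp) //.
have -> : (shift A (- 'i) y, 0) - (shift A 'i y, 0) = (x, 0) :> H * H.
  congr (_, _); last exact: subrr.
  rewrite /= /shift scaleNr opprK opprB [LHS]addrC addrA subrK.
  by rewrite -scalerDl scalerA c1 scale1r.
have -> : 'i *: ((shift A (- 'i) y, 0) + (shift A 'i y, 0)) = (A x, 0) :> H * H.
  congr (_, _) => /=; last by rewrite addr0 scaler0.
  rewrite /shift scaleNr opprK addrACA subrr addr0 Ay scalerDr -scalerDl.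
  by rewrite scalerA c1 scale1r.
by [].
Qed.
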